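(* The embedding $\iota_e:\mathcal S_n\rightarrow \mathrm C^*(\mathbb F_n)$ is pure in the cone $\mathcal{CP}(\mathcal S_n,\mathrm C^*(\mathbb F_n))$ for every $n\geq 2$.
   Context: $\mathbb F_n$ is the free group on generators $u_1,\dots,u_n$, $\mathrm C^*(\mathbb F_n)$ is its full group C$^*$-algebra (in which group elements are regarded as unitaries), and $\mathcal S_n=\mathrm{Span}\{1,u_k,u_k^*\mid k=1,\dots,n\}\subset\mathrm C^*(\mathbb F_n)$, an operator system (unital selfadjoint subspace). $\iota_e$ is the inclusion map (and $(\mathrm C^*(\mathbb F_n),\iota_e)$ is the C$^*$-envelope of $\mathcal S_n$). For operator systems $\mathcal R,\mathcal T$, $\mathcal{CP}(\mathcal R,\mathcal T)$ is the convex cone of completely positive linear maps $\mathcal R\to\mathcal T$; $\phi$ is pure in this cone if, whenever $\vartheta,\omega\in\mathcal{CP}(\mathcal R,\mathcal T)$ satisfy $\vartheta+\omega=\phi$, there is $s\in[0,1]$ with $\vartheta=s\phi$ and $\omega=(1-s)\phi$. *)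

(* Defs.v *)
From HB Require Import structures.
From mathcomp Require Import all_boot all_order all_algebra.
From mathcomp Require Import finmap.
From mathcomp Require Import all_classical all_reals all_analysis.
From mathcomp Require Import complex sesquilinear.
Set Implicit Arguments.
Unset Strict Implicit.
Unset Printing Implicit Defensive.
Import Order.TTheory GRing.Theory Num.Theory.
Import numFieldNormedType.Exports.
Local Open Scope classical_set_scope.
Local Open Scope ring_scope.

(* The free group on n generators, as reduced words. The letter (k, false)
   stands for the generator u_k and (k, true) for its inverse. *)
Section FreeGroup.
Variable n : nat.

Local Notation letter := ('I_n * bool)%type.

Definition letter_inv (a : letter) : letter := (a.1, ~~ a.2).

Definition reduced (w : seq letter) : bool :=
  sorted (fun a b => b != letter_inv a) w.

Definition cons_red (a : letter) (w : seq letter) : seq letter :=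
  if w is b :: w' then if b == letter_inv a then w' else a :: w else [:: a].

Definition mul_red (v w : seq letter) : seq letter := foldr cons_red w v.

Definition inv_red (w : seq letter) : seq letter := rev (map letter_inv w).

Lemma letter_invK : involutive letter_inv.
Proof. by case=> k b; rewrite /letter_inv /= negbK. Qed.

Lemma reduced_cons a w : reduced (a :: w) -> reduced w.
Proof. by case: w => // b w /= /andP[]. Qed.

Lemma cons_red_reduced a w : reduced w -> reduced (cons_red a w).
Proof.
case: w => // b w rw /=; case: ifP => [_|/negbT ab]; first exact: reduced_cons rw.
by rewrite /= ab.
Qed.

Lemma cons_red_invK a w :
  reduced w -> cons_red (letter_inv a) (cons_red a w) = w.
Proof.
case: w => [_|b w rw] /=; first by rewrite letter_invK eqxx.
case: ifP => [/eqP <-|_] /=; last by rewrite letter_invK eqxx.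
by case: w rw => // c w /= /andP[/negPf ->].
Qed.

Lemma cons_redK a w :
  reduced w -> cons_red a (cons_red (letter_inv a) w) = w.
Proof. by move=> rw; have := cons_red_invK (letter_inv a) rw; rewrite letter_invK. Qed.

Lemma mul_red_reduced v w : reduced w -> reduced (mul_red v w).
Proof. by move=> rw; elim: v => //= a v IH; exact: cons_red_reduced. Qed.

Lemma cons_mul_red a v w : reduced w ->
  mul_red (cons_red a v) w = cons_red a (mul_red v w).
Proof.
move=> rw; case: v => // b v /=; case: ifP => // /eqP ->.
by rewrite cons_redK // mul_red_reduced.
Qed.

Lemma mul_redA u v w : reduced w ->
  mul_red u (mul_red v w) = mul_red (mul_red u v) w.
Proof. by move=> rw; elim: u => //= a u ->; rewrite cons_mul_red. Qed.

Lemma mul_red0 w : reduced w -> mul_red w [::] = w.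
Proof.
elim: w => // a w IH rw; rewrite /= IH ?(reduced_cons rw)//.
by case: w rw {IH} => //= b w /andP[/negPf ->].
Qed.

Lemma inv_red_reduced w : reduced w -> reduced (inv_red w).
Proof.
rewrite /reduced /inv_red rev_sorted sorted_map; apply: sub_sorted => a b /=.
by rewrite letter_invK eq_sym (can2_eq letter_invK letter_invK).
Qed.

Lemma mul_inv_red v w : reduced w -> mul_red (inv_red v) (mul_red v w) = w.
Proof.
move=> rw; elim: v => //= a v IH.
rewrite /inv_red /= rev_cons -cats1 /mul_red foldr_cat /=.
by rewrite cons_red_invK ?mul_red_reduced.
Qed.

Lemma inv_redK w : inv_red (inv_red w) = w.
Proof.
by rewrite /inv_red map_rev revK -map_comp (eq_map letter_invK) map_id.
Qed.

Record freeGroup : Type :=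
  FreeGroup { fg_word :> seq letter; fg_reduced : reduced fg_word }.

HB.instance Definition _ := [isSub for fg_word].
HB.instance Definition _ := [Choice of freeGroup by <:].

Definition fg_one : freeGroup := @FreeGroup [::] isT.
Definition fg_mul (v w : freeGroup) : freeGroup :=
  FreeGroup (mul_red_reduced v (fg_reduced w)).
Definition fg_inv (w : freeGroup) : freeGroup :=
  FreeGroup (inv_red_reduced (fg_reduced w)).

Lemma fg_mulA : associative fg_mul.
Proof. by move=> u v w; apply: val_inj; rewrite /= mul_redA ?fg_reduced. Qed.
Lemma fg_mul1 : left_id fg_one fg_mul.
Proof. by move=> w; apply: val_inj. Qed.
Lemma fg_1mul : right_id fg_one fg_mul.
Proof. by move=> w; apply: val_inj; rewrite /= mul_red0 ?fg_reduced. Qed.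
Lemma fg_mulV : left_inverse fg_one fg_inv fg_mul.
Proof.
move=> w; apply: val_inj => /=.
by rewrite -{2}[fg_word w](mul_red0 (fg_reduced w)) mul_inv_red.
Qed.
Lemma fg_Vmul : right_inverse fg_one fg_inv fg_mul.
Proof.
move=> w; have := fg_mulV (fg_inv w); congr (fg_mul _ _ = _).
by apply: val_inj; rewrite /= inv_redK.
Qed.

HB.instance Definition _ := isGroup.Build freeGroup
  fg_mulA fg_mul1 fg_1mul fg_mulV fg_Vmul.

Definition fg_gen (k : 'I_n) : freeGroup := @FreeGroup [:: (k, false)] isT.

End FreeGroup.

HB.mixin Record isHilbert (R : realType) H of CompleteNormedModule R[i] H := {
  (* linear in the first variable, conjugate-linear in the second *)
  inner : {dot H for Num.conj} ;
  inner_norm : forall x : H, inner x x = `|x| ^+ 2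
}.

#[short(type="hilbertType")]
HB.structure Definition Hilbert (R : realType) :=
  {H of CompleteNormedModule R[i] H & isHilbert R H}.

(* Unital complex C*-algebras. The norm is a field here because the library's
   hierarchy cannot join a non-commutative algebra with a normed module.
   The modulus `|c| of c : R[i] lies in R[i], hence the Re. *)
HB.mixin Record isCStarAlgebra (R : realType) A of GRing.Algebra R[i] A := {
  star : A -> A ;
  starK : involutive star ;
  starD : {morph star : x y / x + y} ;
  starZ : forall (c : R[i]) (x : A), star (c *: x) = c^* *: star x ;
  starM : forall x y : A, star (x * y) = star y * star x ;
  cnorm : A -> R ;
  cnorm0_eq0 : forall x : A, cnorm x = 0 -> x = 0 ;
  ler_cnormD : forall x y : A, cnorm (x + y) <= cnorm x + cnorm y ;
  cnormZ : forall (c : R[i]) (x : A),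
    cnorm (c *: x) = complex.Re `|c| * cnorm x ;
  ler_cnormM : forall x y : A, cnorm (x * y) <= cnorm x * cnorm y ;
  cnorm_cstar : forall x : A, cnorm (star x * x) = cnorm x ^+ 2 ;
  cnorm_complete : forall a : nat -> A,
    (forall e : R, 0 < e -> exists N, forall i j,
       (N <= i)%N -> (N <= j)%N -> cnorm (a i - a j) < e) ->
    exists l : A, forall e : R, 0 < e -> exists N, forall i,
       (N <= i)%N -> cnorm (a i - l) < e
}.

#[short(type="cstarAlgType")]
HB.structure Definition CStarAlgebra (R : realType) :=
  {A of GRing.Algebra R[i] A & isCStarAlgebra R A}.

Section GroupCStar.
Variables (R : realType) (G : groupType).

(* Each rep g is invertible by rep1 and repM, so repU makes it unitary. *)
Record unitaryRep (H : hilbertType R) := UnitaryRep {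
  rep :> G -> {linear H -> H} ;
  rep1 : forall x, rep 1%g x = x ;
  repM : forall g h x, rep (g * h)%g x = rep g (rep h x) ;
  repU : forall g x y, inner (rep g x) (rep g y) = inner x y
}.

(* An element of the group algebra C[G] is a finitely supported function. *)
Definition groupAlg : Type := {fsfun G -> R[i] with 0}.

Definition rep_alg (H : hilbertType R) (pi : unitaryRep H) (f : groupAlg)
    (x : H) : H :=
  \sum_(g <- finsupp f) f g *: pi g x.

(* The supremum of the operator norms of pi(f) over all unitary
   representations pi of G. *)
Definition max_norm (f : groupAlg) : R :=
  sup [set r : R | exists (H : hilbertType R) (pi : unitaryRep H) (x : H),
         `|x| <= 1 /\ `|rep_alg pi f x| = r%:C%C].

Definition alg_image (A : cstarAlgType R) (U : G -> A) (f : groupAlg) : A :=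
  \sum_(g <- finsupp f) f g *: U g.

(* (A, U) is the full group C*-algebra of G: the *-homomorphism from C[G] to A
   extending U identifies A with the completion of C[G] in the maximal norm. *)
Record is_full_group_cstar (A : cstarAlgType R) (U : G -> A) : Prop := {
  fgc_1 : U 1%g = 1 ;
  fgc_M : forall g h, U (g * h)%g = U g * U h ;
  fgc_star : forall g, star (U g) = U (g^-1)%g ;
  fgc_dense : forall (x : A) (e : R), 0 < e ->
    exists f : groupAlg, cnorm (x - alg_image U f) < e ;
  fgc_norm : forall f, cnorm (alg_image U f) = max_norm f
}.

End GroupCStar.

Section OperatorSystems.
Variables (R : realType) (A : cstarAlgType R).

Record opSys := OpSys {
  opsys_pred : {pred A} ;
  opsys_submod : submod_closed opsys_pred ;
  opsys_1 : 1 \in opsys_pred ;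
  opsys_star : forall x, x \in opsys_pred -> star x \in opsys_pred
}.

Variable S : opSys.

HB.instance Definition _ :=
  GRing.isSubmodClosed.Build R[i] A (opsys_pred S) (opsys_submod S).

Record opsys_sort : Type :=
  OpSysElt { opsys_val : A; opsys_valP : opsys_val \in opsys_pred S }.

HB.instance Definition _ := [isSub for opsys_val].
HB.instance Definition _ := [Choice of opsys_sort by <:].
HB.instance Definition _ := [SubChoice_isSubLmodule of opsys_sort by <:].

Definition opsys_incl : {linear opsys_sort -> A} := (\val : {linear _ -> _}).

End OperatorSystems.

Coercion opsys_sort : opSys >-> Sortclass.

Section CompletelyPositive.
Variable R : realType.

(* Positivity in the C*-algebra M_p(A), whose involution is the conjugate
   transpose: X is positive iff X = Y^* Y for some Y. *)
Definition mx_positive (A : cstarAlgType R) (p : nat) (X : 'M[A]_p) : Prop :=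
  exists Y : 'M[A]_p, X = (map_mx star Y)^T *m Y.

Variables (A B : cstarAlgType R) (S : opSys A).

Definition completely_positive (phi : {linear S -> B}) : Prop :=
  forall (p : nat) (X : 'M[S]_p),
    mx_positive (map_mx (opsys_incl S) X) -> mx_positive (map_mx phi X).

Definition pure_in_CP (phi : {linear S -> B}) : Prop :=
  completely_positive phi /\
  forall theta omega : {linear S -> B},
    completely_positive theta -> completely_positive omega ->
    (forall x, theta x + omega x = phi x) ->
    exists s : R, [/\ 0 <= s <= 1,
      forall x, theta x = s%:C%C *: phi x &
      forall x, omega x = (1 - s)%:C%C *: phi x].

End CompletelyPositive.

Section SpanSystem.
Variables (R : realType) (A : cstarAlgType R) (n : nat) (u : 'I_n -> A).

Definition span_pred : {pred A} :=
  [pred x | `[< exists (a : R[i]) (b c : 'I_n -> R[i]),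
     x = a *: 1 + \sum_(k < n) (b k *: u k + c k *: star (u k)) >]].

Lemma span_predP x :
  x \in span_pred <-> exists (a : R[i]) (b c : 'I_n -> R[i]),
     x = a *: 1 + \sum_(k < n) (b k *: u k + c k *: star (u k)).
Proof. by rewrite inE /=; split=> [/asboolP|h] //; apply/asboolP. Qed.

Lemma star0 : star (0 : A) = 0.
Proof. by apply: (addrI (star 0)); rewrite -starD !addr0. Qed.

Lemma star1 : star (1 : A) = 1.
Proof. by rewrite -[LHS]mulr1 -{2}[1](starK 1) -starM mulr1 starK. Qed.

Lemma span_submod : submod_closed span_pred.
Proof.
split=> [|t x y /span_predP[a [b [c ->]]] /span_predP[a' [b' [c' ->]]]]; apply/span_predP.
  exists 0, (fun=> 0), (fun=> 0).
  by rewrite scale0r add0r big1 // => k _; rewrite !scale0r addr0.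
exists (t * a + a'), (fun k => t * b k + b' k), (fun k => t * c k + c' k).
rewrite scalerDr scaler_sumr scalerA addrACA -scalerDl -big_split /=.
congr (_ + _); apply: eq_bigr => k _.
by rewrite scalerDr !scalerA addrACA -!scalerDl.
Qed.

Lemma span_1 : 1 \in span_pred.
Proof.
apply/span_predP; exists 1, (fun=> 0), (fun=> 0).
by rewrite scale1r big1 ?addr0 // => k _; rewrite !scale0r addr0.
Qed.

Lemma span_star x : x \in span_pred -> star x \in span_pred.
Proof.
move=> /span_predP[a [b [c ->]]]; apply/span_predP.
exists a^*, (fun k => (c k)^*), (fun k => (b k)^*).
rewrite starD starZ star1 (big_morph star starD star0); congr (_ + _).
by apply: eq_bigr => k _; rewrite starD !starZ starK addrC.
Qed.

Definition span_opsys : opSys A := OpSys span_submod span_1 span_star.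

End SpanSystem.

(* Main.v *)
(* Let [theta + omega] be the inclusion. The positive matrix
   [[1, u], [u^*, 1]] kills the vector [(u, -1)], hence so do its images under
   [theta] and [omega]; this gives [theta u = a u] and [u a = a u] for every
   generator [u], where [a = theta 1]. It remains to see that an element [a]
   commuting with two generators is a scalar.

   Let [V] and [W] be unitary representations on [H] that agree on a generator
   [v] commuting with [a]. On [H (+) H], compose the action of [v] with a
   rotation of the two summands by the angle [pi / 2m]. This perturbs
   [V (+) W], hence the image of a fixed group-algebra element close to [a], by
   [O(1/m)], while [v^m] now exchanges the two summands and still commutes with
   the image of [a]. Letting [m] tend to infinity, [V(a) = 0] as soon as
   [W(a) = 0]. Going from an arbitrary representation to the one that kills
   all generators but the first, and from there, through the second generator,
   to the trivial one shows that [a] minus its value in the trivial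
   representation vanishes in every representation. *)
Require Import Defs.
From HB Require Import structures.
From mathcomp Require Import all_boot all_order all_algebra.
From mathcomp Require Import finmap.
From mathcomp Require Import all_classical all_reals all_analysis.
From mathcomp Require Import complex sesquilinear ring lra.
Set Implicit Arguments.
Unset Strict Implicit.
Unset Printing Implicit Defensive.
Import Order.TTheory GRing.Theory Num.Theory.
Import numFieldNormedType.Exports.
Local Open Scope classical_set_scope.
Local Open Scope ring_scope.

(** * Real-valued norms *)

Section RealNorm.
Variable R : realType.

(** The norm over [R[i]] is itself a complex number, though a real one; its real part lives in [R],
    where suprema and linear arithmetic are available. *)
Definition nrm (V : normedZmodType R[i]) (x : V) : R := complex.Re `|x|.

Lemma nrmE (V : normedZmodType R[i]) (x : V) : `|x| = (nrm x)%:C%C.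
Proof. by rewrite RRe_real // ger0_real. Qed.

Lemma nrm_ge0 (V : normedZmodType R[i]) (x : V) : 0 <= nrm x.
Proof. by rewrite -ler0c -nrmE. Qed.

Lemma ler_nrmD (V : normedZmodType R[i]) (x y : V) :
  nrm (x + y) <= nrm x + nrm y.
Proof. by rewrite -lecR rmorphD /= -!nrmE ler_normD. Qed.

Lemma nrmN (V : normedZmodType R[i]) (x : V) : nrm (- x) = nrm x.
Proof. by rewrite /nrm normrN. Qed.

Lemma nrm0 (V : normedZmodType R[i]) : nrm (0 : V) = 0.
Proof. by rewrite /nrm normr0. Qed.

Lemma nrm0_eq0 (V : normedZmodType R[i]) (x : V) : nrm x = 0 -> x = 0.
Proof. by move=> x0; apply/eqP; rewrite -normr_eq0 nrmE x0. Qed.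

Lemma nrmZ (V : normedModType R[i]) (c : R[i]) (x : V) :
  nrm (c *: x) = nrm c * nrm x.
Proof. by apply: complexI; rewrite rmorphM /= -!nrmE normrZ. Qed.

Lemma nrmc (c : R) : nrm (c%:C%C : R[i]) = `|c|.
Proof. by rewrite /nrm normc_def /= expr0n addr0 sqrtr_sqr. Qed.

Lemma ler_nrmB (V : normedZmodType R[i]) (x y : V) : nrm x - nrm y <= nrm (x - y).
Proof. by rewrite lerBlDr; have := ler_nrmD (x - y) y; rewrite subrK. Qed.

Lemma ler_nrm_sum (V : normedZmodType R[i]) (I : Type) (r : seq I) (F : I -> V) :
  nrm (\sum_(i <- r) F i) <= \sum_(i <- r) nrm (F i).
Proof.
elim: r => [|i r IH]; first by rewrite !big_nil nrm0.
by rewrite !big_cons (le_trans (ler_nrmD _ _)) // lerD2l.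
Qed.

Lemma ball_nrm (V : normedModType R[i]) (x y : V) (e : R[i]) :
  ball x e y <-> (nrm (x - y))%:C%C < e.
Proof. by rewrite -nrmE -ball_normE. Qed.

End RealNorm.

(** * Cauchy-Schwarz inequality *)

Section Inner.
Variables (R : realType) (H : hilbertType R).

Lemma inner_conj (x y : H) :
  inner x y = Num.conj (inner y x).
Proof. by rewrite {1}hermC /= expr0 mul1r. Qed.

Lemma nrm_inner (x y : H) : inner x x = inner y y -> nrm x = nrm y.
Proof.
rewrite !inner_norm !nrmE -!rmorphXn => /complexI /eqP.
by rewrite eqrXn2 ?nrm_ge0 // => /eqP.
Qed.

(** By polarization [4 * Re <z, w>] is a difference of squared norms, which the two triangle
    inequalities bound by [(|z| + |w|)^2 - (|z| - |w|)^2]. *)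
Lemma re_inner_le (x y : H) : `|complex.Re (inner x y)| <= nrm x * nrm y.
Proof.
have D (z w : H) : 4 * complex.Re (inner z w) = nrm (z + w) ^+ 2 - nrm (z - w) ^+ 2.
  apply: complexI; rewrite rmorphB !rmorphXn /= -!nrmE -!inner_norm.
  rewrite dnormD dnormB; case: (inner z w) (inner z z) (inner w w) => a b [c d] [e f] /=.
  by apply/eqP; rewrite eq_complex /=; apply/andP; split; apply/eqP; ring.
have L (z w : H) : complex.Re (inner z w) <= nrm z * nrm w.
  have := D z w; have := ler_nrmD z w; have := ler_nrmB z w.
  have := ler_nrmB w z; rewrite -(opprB z w) nrmN.
  have := nrm_ge0 (z - w); have := nrm_ge0 (z + w).
  have := nrm_ge0 z; have := nrm_ge0 w; nra.
rewrite ler_norml L andbT lerNl -linearN /=.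
by have := L (- x) y; rewrite nrmN linearNl /= linearN.
Qed.

End Inner.

(** * The orthogonal sum of two Hilbert spaces *)

Section DirectSum.
Variable R : realType.

Lemma minkowski2 (a b c d : R) :
  Num.sqrt ((a + c) ^+ 2 + (b + d) ^+ 2)
    <= Num.sqrt (a ^+ 2 + b ^+ 2) + Num.sqrt (c ^+ 2 + d ^+ 2).
Proof.
set s := Num.sqrt (a ^+ 2 + b ^+ 2); set t := Num.sqrt (c ^+ 2 + d ^+ 2).
have s0 : 0 <= s by exact: sqrtr_ge0.
have t0 : 0 <= t by exact: sqrtr_ge0.
have sE : s ^+ 2 = a ^+ 2 + b ^+ 2 by rewrite sqr_sqrtr // addr_ge0 ?sqr_ge0.
have tE : t ^+ 2 = c ^+ 2 + d ^+ 2 by rewrite sqr_sqrtr // addr_ge0 ?sqr_ge0.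
rewrite -(ger0_norm (addr_ge0 s0 t0)) -sqrtr_sqr ler_sqrt ?sqr_ge0 //.
(* Cauchy-Schwarz in the plane; the defect of the squares is [(a * d - b * c) ^+ 2]. *)
have st : a * c + b * d <= s * t.
  rewrite (le_trans (ler_norm _)) // -(ger0_norm (mulr_ge0 s0 t0)).
  rewrite -ler_sqr ?nnegrE ?normr_ge0 // !real_normK ?num_real //.
  rewrite exprMn sE tE; have := sqr_ge0 (a * d - b * c); nra.
rewrite (sqrrD s t) sE tE; nra.
Qed.

Variables H K : hilbertType R.

(** A fresh name for the product, because the plain product carries the maximum norm, which comes
    from no inner product. *)
Definition dsum : Type := (H * K)%type.

HB.instance Definition _ := GRing.Lmodule.copy dsum (H * K)%type.

Definition dsum_norm (x : dsum) : R[i] :=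
  (Num.sqrt (nrm x.1 ^+ 2 + nrm x.2 ^+ 2))%:C%C.

Lemma dsum_normD (x y : dsum) : dsum_norm (x + y) <= dsum_norm x + dsum_norm y.
Proof.
rewrite /dsum_norm -rmorphD lecR (le_trans _ (minkowski2 _ _ _ _)) //.
rewrite ler_sqrt ?addr_ge0 ?sqr_ge0 //.
by apply: lerD; rewrite lerXn2r ?nnegrE ?addr_ge0 ?nrm_ge0 // ler_nrmD.
Qed.

Lemma dsum_normZ (c : R[i]) (x : dsum) : dsum_norm (c *: x) = `|c| * dsum_norm x.
Proof.
rewrite /dsum_norm nrmE -rmorphM /=; congr _%:C%C.
rewrite !nrmZ !exprMn -mulrDr sqrtrM ?sqr_ge0 // sqrtr_sqr.
by rewrite ger0_norm // nrm_ge0.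
Qed.

Lemma dsum_norm0_eq0 (x : dsum) : dsum_norm x = 0 -> x = 0.
Proof.
move=> /complexI /eqP; rewrite sqrtr_eq0.
rewrite le_eqVlt ltNge addr_ge0 ?sqr_ge0 // orbF paddr_eq0 ?sqr_ge0 //.
rewrite !sqrf_eq0 => /andP[/eqP /nrm0_eq0 x1 /eqP /nrm0_eq0 x2].
by case: x x1 x2 => /= x y -> ->.
Qed.

HB.instance Definition _ := Lmodule_isNormed.Build R[i] dsum
  dsum_normD dsum_normZ dsum_norm0_eq0.

Lemma nrm_dsum (x : dsum) : nrm x = Num.sqrt (nrm x.1 ^+ 2 + nrm x.2 ^+ 2).
Proof. by []. Qed.

Lemma nrm_dsum1 (x : dsum) : nrm x.1 <= nrm x.
Proof.
rewrite nrm_dsum -[leLHS]ger0_norm ?nrm_ge0 // -sqrtr_sqr ler_sqrt.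
  by rewrite lerDl sqr_ge0.
by rewrite addr_ge0 ?sqr_ge0.
Qed.

Lemma nrm_dsum2 (x : dsum) : nrm x.2 <= nrm x.
Proof.
rewrite nrm_dsum -[leLHS]ger0_norm ?nrm_ge0 // -sqrtr_sqr ler_sqrt.
  by rewrite lerDr sqr_ge0.
by rewrite addr_ge0 ?sqr_ge0.
Qed.

Lemma nrm_dsum_l (x : H) : nrm ((x, 0) : dsum) = nrm x.
Proof. by rewrite nrm_dsum /= nrm0 expr0n addr0 sqrtr_sqr ger0_norm ?nrm_ge0. Qed.

Lemma nrm_dsum_r (x : K) : nrm ((0, x) : dsum) = nrm x.
Proof. by rewrite nrm_dsum /= nrm0 expr0n add0r sqrtr_sqr ger0_norm ?nrm_ge0. Qed.

Lemma nrm_dsum_le (x : dsum) : nrm x <= nrm x.1 + nrm x.2.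
Proof.
have -> : x = (x.1, 0) + (0, x.2) :> dsum.
  by case: x => a b; congr pair; rewrite /= ?addr0 ?add0r.
by rewrite (le_trans (ler_nrmD _ _)) // nrm_dsum_l nrm_dsum_r /= addr0 add0r.
Qed.

Lemma nrm_dsumB1 (x y : dsum) : nrm (x.1 - y.1) <= nrm (x - y).
Proof. by have := nrm_dsum1 (x - y). Qed.

Lemma nrm_dsumB2 (x y : dsum) : nrm (x.2 - y.2) <= nrm (x - y).
Proof. by have := nrm_dsum2 (x - y). Qed.

Lemma nrm_dsumB (x y : dsum) : nrm (x - y) <= nrm (x.1 - y.1) + nrm (x.2 - y.2).
Proof. by have := nrm_dsum_le (x - y). Qed.

Lemma dsum_complete (F : set_system dsum) : ProperFilter F -> cauchy F -> cvg F.
Proof.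
move=> FF /cauchyP FC.
have C1 : cvg (fst @ F).
  apply: cauchy_cvg; apply/cauchyP => e e0.
  have [x Fx] := FC _ e0; exists x.1.
  apply: (@filterS _ F _ _ _ _ Fx) => y /ball_nrm xye.
  by apply/ball_nrm; apply: le_lt_trans xye; rewrite lecR nrm_dsumB1.
have C2 : cvg (snd @ F).
  apply: cauchy_cvg; apply/cauchyP => e e0.
  have [x Fx] := FC _ e0; exists x.2.
  apply: (@filterS _ F _ _ _ _ Fx) => y /ball_nrm xye.
  by apply/ball_nrm; apply: le_lt_trans xye; rewrite lecR nrm_dsumB2.
apply/cvg_ex; exists ((lim (fst @ F), lim (snd @ F)) : dsum).
apply/cvgrPdist_lt => e e0; have e20 : 0 < e / 2 by rewrite divr_gt0.
move/cvgrPdist_lt: C1 => /(_ _ e20) F1; move/cvgrPdist_lt: C2 => /(_ _ e20) F2.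
apply: filterS2 F1 F2 => x; rewrite !nrmE => x1 x2.
rewrite [ltRHS]splitr; apply: le_lt_trans (ltrD x1 x2).
by rewrite -rmorphD lecR nrm_dsumB.
Qed.

HB.instance Definition _ := Uniform_isComplete.Build dsum dsum_complete.

Definition dsum_inner (x y : dsum) : R[i] := inner x.1 y.1 + inner x.2 y.2.

Fact dsum_inner_bilinear :
  bilinear_for *%R (Num.conj \; *%R) dsum_inner.
Proof.
split=> [z|z] c x y; rewrite /dsum_inner /=.
  by rewrite !linearPl /= mulrDr addrACA.
by rewrite !linearPr /= mulrDr addrACA.
Qed.

HB.instance Definition _ := bilinear_isBilinear.Build R[i] dsum dsum R[i]
  *%R (Num.conj \; *%R) dsum_inner dsum_inner_bilinear.

Fact dsum_inner_herm (x y : dsum) :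
  dsum_inner x y = (-1) ^+ false * Num.conj (dsum_inner y x).
Proof.
rewrite expr0 mul1r /dsum_inner rmorphD /=.
by rewrite -(inner_conj x.1 y.1) -(inner_conj x.2 y.2).
Qed.

HB.instance Definition _ := isHermitianSesquilinear.Build R[i] dsum
  false Num.conj dsum_inner dsum_inner_herm.

Fact dsum_inner_norm (x : dsum) : dsum_inner x x = `|x| ^+ 2.
Proof.
rewrite /dsum_inner !inner_norm !nrmE -!rmorphXn -rmorphD /= nrm_dsum sqr_sqrtr //.
by rewrite addr_ge0 ?sqr_ge0.
Qed.

Fact dsum_inner_gt0 (x : dsum) : x != 0 -> 0 < dsum_inner x x.
Proof. by move=> x0; rewrite dsum_inner_norm exprn_gt0 // normr_gt0. Qed.

HB.instance Definition _ := isDotProduct.Build R[i] dsum dsum_inner dsum_inner_gt0.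

HB.instance Definition _ := isHilbert.Build R dsum dsum_inner_norm.

End DirectSum.

(** * The full group C*-algebra *)

Section GroupPolynomials.
Variables (R : realType) (G : groupType).
Local Notation C := R[i].

(* A list of pairs [(c, g)] stands for the element [\sum c g] of the group
   algebra; unlike finitely supported functions, lists can be multiplied
   without regrouping. *)
Definition gpoly : Type := seq (C * G).

Definition gp_eval (M : lmodType C) (F : G -> M) (s : gpoly) : M :=
  \sum_(p <- s) p.1 *: F p.2.

Definition gp_mul (s t : gpoly) : gpoly :=
  [seq (p.1 * q.1, (p.2 * q.2)%g) | p <- s, q <- t].

Definition gp_star (s : gpoly) : gpoly := [seq (Num.conj p.1, p.2^-1%g) | p <- s].

Definition gp_opp (s : gpoly) : gpoly := [seq (- p.1, p.2) | p <- s].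

Section Eval.
Variables (M : lmodType C) (F : G -> M).

Lemma gp_eval_nil : gp_eval F [::] = 0. Proof. exact: big_nil. Qed.

Lemma gp_eval_cons p s : gp_eval F (p :: s) = p.1 *: F p.2 + gp_eval F s.
Proof. exact: big_cons. Qed.

Lemma gp_eval_cat s t : gp_eval F (s ++ t) = gp_eval F s + gp_eval F t.
Proof. exact: big_cat. Qed.

Lemma gp_eval_opp s : gp_eval F (gp_opp s) = - gp_eval F s.
Proof. by rewrite /gp_eval big_map -sumrN; apply: eq_bigr => p _; rewrite scaleNr. Qed.

Lemma gp_eval_flatten (ss : seq gpoly) :
  gp_eval F (flatten ss) = \sum_(s <- ss) gp_eval F s.
Proof. by rewrite /gp_eval big_flatten. Qed.

(** Collecting the terms of a list by group element does not change its value. This transfers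
    [fgc_dense] and [fgc_norm] from finitely supported functions to lists. *)
Lemma gp_eval_fsfun (s : gpoly) (f : groupAlg R G) :
  (forall g, f g = \sum_(p <- s | p.2 == g) p.1) ->
  \sum_(g <- finsupp f) f g *: F g = gp_eval F s.
Proof.
move=> fE; pose D := [fset p.2 | p in s]%fset.
have fD : (finsupp f `<=` D)%fset.
  apply/fsubsetP => g; rewrite mem_finsupp fE; apply: contraR => gD.
  rewrite big_seq_cond big1 // => p /andP[ps /eqP pg].
  by case/negP: gD; apply/imfsetP; exists p.
rewrite (big_fset_incl _ fD) => [|g _]; last first.
  by rewrite mem_finsupp negbK => /eqP ->; rewrite scale0r.
under eq_bigr => g _ do rewrite fE scaler_suml big_mkcond.
rewrite exchange_big /= /gp_eval [LHS]big_seq [RHS]big_seq.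
apply: eq_bigr => p ps.
have pD : p.2 \in D by apply/imfsetP; exists p.
rewrite (big_fsetD1 _ pD) /= eqxx big_seq big1 ?addr0 // => g.
by rewrite !inE eq_sym => /andP[/negPf ->].
Qed.

End Eval.

Lemma gp_eval_groupAlg (f : groupAlg R G) (M : lmodType C) (F : G -> M) :
  gp_eval F [seq (f g, g) | g <- finsupp f] = \sum_(g <- finsupp f) f g *: F g.
Proof. by rewrite /gp_eval big_map. Qed.

Lemma gpoly_fsfun (s : gpoly) : exists f : groupAlg R G,
  forall g, f g = \sum_(p <- s | p.2 == g) p.1.
Proof.
exists [fsfun g in [fset p.2 | p in s]%fset => \sum_(p <- s | p.2 == g) p.1] => g.
rewrite fsfunE; case: ifPn => // gD; rewrite big_seq_cond big1 // => p /andP[ps /eqP pg].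
by case/negP: gD; apply/imfsetP; exists p.
Qed.

Section Rep.
Variables (H : hilbertType R) (pi : unitaryRep G H).

Definition rep_gp (s : gpoly) (x : H) : H := gp_eval (fun g => pi g x) s.

Lemma repK g x : pi (g^-1)%g (pi g x) = x.
Proof. by rewrite -repM mulVg rep1. Qed.

Lemma nrm_rep g x : nrm (pi g x) = nrm x.
Proof.
apply/eqP; rewrite -(eqrXn2 (n := 2)) ?nrm_ge0 //.
by apply/eqP/complexI; rewrite !rmorphXn /= -!nrmE -!inner_norm repU.
Qed.

Lemma rep_gpZ s c x : rep_gp s (c *: x) = c *: rep_gp s x.
Proof.
rewrite /rep_gp /gp_eval scaler_sumr; apply: eq_bigr => p _.
by rewrite linearZ /= !scalerA mulrC.
Qed.

Lemma rep_gp0 s : rep_gp s 0 = 0.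
Proof. by rewrite -[0 in LHS](scale0r (0 : H)) rep_gpZ scale0r. Qed.

Lemma rep_gp_mul s t x : rep_gp (gp_mul s t) x = rep_gp s (rep_gp t x).
Proof.
rewrite /rep_gp /gp_eval big_allpairs_dep; apply: eq_bigr => p _.
rewrite linear_sum scaler_sumr; apply: eq_bigr => q _.
by rewrite /= repM linearZ /= scalerA.
Qed.

Lemma inner_rep_gp_star s x y : inner (rep_gp (gp_star s) x) y = inner x (rep_gp s y).
Proof.
rewrite /rep_gp /gp_eval big_map; elim: s => [|p s IH].
  by rewrite !big_nil linear0l linear0r.
rewrite !big_cons linearDr linearDl /= IH linearZl_LR linearZr_LR /=; congr (_ * _ + _).
by rewrite -(repU pi p.2) -repM mulgV rep1.
Qed.

(** The bound does not depend on the representation, so the set whose supremum is [max_norm] is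
    bounded above. *)
Lemma nrm_rep_gp s x : nrm (rep_gp s x) <= (\sum_(p <- s) nrm p.1) * nrm x.
Proof.
rewrite mulr_suml (le_trans (ler_nrm_sum _ _)) // ler_sum // => p _.
by rewrite nrmZ nrm_rep.
Qed.

End Rep.
End GroupPolynomials.

(** * Consequences of the C*-identity *)

Section CNorm.
Variables (R : realType) (A : cstarAlgType R).
Local Notation C := R[i].

Lemma cnorm0 : cnorm (0 : A) = 0.
Proof. by rewrite -[0 in LHS](scale0r (0 : A)) cnormZ normr0 mul0r. Qed.

Lemma cnormN (x : A) : cnorm (- x) = cnorm x.
Proof. by rewrite -scaleN1r cnormZ normrN normr1 mul1r. Qed.

Lemma cnorm_ge0 (x : A) : 0 <= cnorm x.
Proof.
have := ler_cnormD x (- x); rewrite subrr cnorm0 cnormN => x2.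
by rewrite -(pmulr_rge0 _ (ltr0n R 2)) mulr_natl mulr2n.
Qed.

Lemma cnorm1 : cnorm (1 : A) = 1.
Proof.
have := cnorm_cstar (1 : A); rewrite star1 mulr1 => /eqP.
rewrite -subr_eq0 -{1}[cnorm 1]mulr1 expr2 -mulrBr mulf_eq0 => /orP[/eqP /cnorm0_eq0 e|].
  by have := oner_neq0 A; rewrite e eqxx.
by rewrite subr_eq0 => /eqP ->.
Qed.

(** The C*-identity and submultiplicativity give [cnorm y ^+ 2 <= cnorm (star y) * cnorm y]; cancel
    [cnorm y] and use the result for both [x] and [star x]. *)
Lemma cnorm_star (x : A) : cnorm (star x) = cnorm x.
Proof.
have L (y : A) : cnorm y <= cnorm (star y).
  have [y0|] := eqVneq (cnorm y) 0; first by rewrite y0 cnorm_ge0.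
  rewrite neq_lt ltNge cnorm_ge0 /= => y0.
  by rewrite -(ler_pM2r y0) -expr2 -cnorm_cstar ler_cnormM.
by apply/eqP; rewrite eq_le (L x) andbT -{2}[x]starK L.
Qed.

Lemma ler_cnormB (x y : A) : cnorm (x - y) <= cnorm x + cnorm y.
Proof. by rewrite -[leRHS](congr1 (+%R _) (cnormN y)) ler_cnormD. Qed.

Lemma ler_cnorm_sum (I : Type) (r : seq I) (F : I -> A) :
  cnorm (\sum_(i <- r) F i) <= \sum_(i <- r) cnorm (F i).
Proof.
elim: r => [|i r IH]; first by rewrite !big_nil cnorm0.
by rewrite !big_cons (le_trans (ler_cnormD _ _)) // lerD2l.
Qed.

Lemma cnorm_eps_eq0 (x : A) (K : R) :
  (forall e, 0 < e -> e <= 1 -> cnorm x <= K * e) -> x = 0.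
Proof.
move=> xK; apply: cnorm0_eq0; apply/eqP; rewrite eq_le cnorm_ge0 andbT leNgt.
apply/negP => x0.
have K0 : 0 < K by have := xK 1 ltr01 (lexx _); rewrite mulr1; apply: lt_le_trans.
(* For this [e] the hypothesis would read [cnorm x <= cnorm x / 2]. *)
pose e := Num.min 1 (cnorm x / K / 2).
have e0 : 0 < e by rewrite lt_min ltr01 !divr_gt0.
have e1 : e <= 1 by rewrite ge_min lexx.
have e2 : e <= cnorm x / K / 2 by rewrite ge_min lexx orbT.
have := xK e e0 e1; apply/negP; rewrite -ltNge.
rewrite (le_lt_trans (ler_wpM2l (ltW K0) e2)) //.
have -> : K * (cnorm x / K / 2) = cnorm x / 2 by field; rewrite gt_eqF.
by rewrite ltr_pdivrMr // ltr_pMr // ltr1n.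
Qed.

End CNorm.

(** * The maximal norm and sums of squares *)

Section FullGroup.
Variables (R : realType) (G : groupType) (A : cstarAlgType R) (U : G -> A).
Hypothesis hU : is_full_group_cstar U.
Local Notation C := R[i].

Lemma gp_eval_mul (s t : gpoly R G) :
  gp_eval U (gp_mul s t) = gp_eval U s * gp_eval U t.
Proof.
rewrite /gp_eval big_allpairs_dep mulr_suml; apply: eq_bigr => p _.
rewrite mulr_sumr; apply: eq_bigr => q _.
by rewrite /= (fgc_M hU) -scalerAl -scalerAr scalerA.
Qed.

Lemma gp_eval_star (s : gpoly R G) : gp_eval U (gp_star s) = star (gp_eval U s).
Proof.
rewrite /gp_eval big_map (big_morph star (@starD _ A) (@star0 _ A)).
by apply: eq_bigr => p _; rewrite starZ (fgc_star hU).
Qed.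

Lemma gpoly_dense (x : A) (e : R) : 0 < e ->
  exists s : gpoly R G, cnorm (x - gp_eval U s) < e.
Proof.
move=> /(fgc_dense hU x)[f xf]; exists [seq (f g, g) | g <- finsupp f].
by rewrite gp_eval_groupAlg.
Qed.

Lemma nrm_rep_gp_le (H : hilbertType R) (pi : unitaryRep G H) (s : gpoly R G) x :
  nrm (rep_gp pi s x) <= cnorm (gp_eval U s) * nrm x.
Proof.
have [f fE] := gpoly_fsfun s.
have -> : cnorm (gp_eval U s) = max_norm f.
  by rewrite -(fgc_norm hU) /alg_image (gp_eval_fsfun _ fE).
have unit_le (y : H) : `|y| <= 1 -> nrm (rep_gp pi s y) <= max_norm f.
  move=> y1; apply: ub_le_sup; last first.
    by exists H, pi, y; split; rewrite // /rep_alg (gp_eval_fsfun _ fE) nrmE.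
  (* An upper bound has to be exhibited before the supremum dominates its elements. *)
  exists (\sum_(p <- s) nrm p.1) => r [H' [pi' [z [z1]]]].
  rewrite /rep_alg (gp_eval_fsfun _ fE) nrmE => /complexI <-.
  apply: le_trans (nrm_rep_gp pi' s z) _; rewrite ler_piMr ?sumr_ge0 // => [p _|].
    exact: nrm_ge0.
  by rewrite -lecR -nrmE.
have [/eqP x0|x0] := eqVneq (nrm x) 0.
  have -> : x = 0 by apply: nrm0_eq0; apply/eqP.
  by rewrite rep_gp0 nrm0 mulr0.
have x_gt0 : 0 < nrm x by rewrite lt_neqAle eq_sym x0 nrm_ge0.
pose y := ((nrm x)^-1)%:C%C *: x.
have yE : nrm y = 1.
  by rewrite nrmZ nrmc ger0_norm ?invr_ge0 ?nrm_ge0 // mulVf.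
have := unit_le y; rewrite nrmE yE => /(_ (lexx _)).
rewrite rep_gpZ nrmZ nrmc ger0_norm ?invr_ge0 ?nrm_ge0 //.
by rewrite mulrC ler_pdivrMr.
Qed.

Lemma cnorm_gp_eval_le (s : gpoly R G) (B : R) : 0 <= B ->
  (forall (H : hilbertType R) (pi : unitaryRep G H) x,
     nrm (rep_gp pi s x) <= B * nrm x) ->
  cnorm (gp_eval U s) <= B.
Proof.
move=> B0 sB; have [f fE] := gpoly_fsfun s.
have -> : cnorm (gp_eval U s) = max_norm f.
  by rewrite -(fgc_norm hU) /alg_image (gp_eval_fsfun _ fE).
rewrite /max_norm; set E := [set r | _].
(* The supremum of the empty set is [0] by convention, hence the hypothesis [0 <= B]. *)
have [->|/set0P E0] := eqVneq E set0; first by rewrite sup0.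
apply: ge_sup => // r [H [pi [x [x1]]]].
rewrite /rep_alg (gp_eval_fsfun _ fE) nrmE => /complexI <-.
apply: le_trans (sB H pi x) _; rewrite ler_piMr //.
by rewrite -lecR -nrmE.
Qed.

(** If every representation space were zero, the maximal norm would vanish on the unit, whose norm
    is [1]. *)
Lemma exists_rep_neq0 :
  exists (H : hilbertType R) (pi : unitaryRep G H) (x : H), 0 < nrm x.
Proof.
apply: contrapT => N.
suff : cnorm (gp_eval U [:: (1, 1%g)]) <= 0.
  by rewrite gp_eval_cons gp_eval_nil addr0 scale1r (fgc_1 hU) cnorm1 ler10.
apply: cnorm_gp_eval_le => // H pi x; rewrite mul0r leNgt; apply/negP => px.
by apply: N; exists H, pi, (rep_gp pi [:: (1, 1%g)] x).
Qed.

(* States of the form [x |-> <pi(x) v, v>] replace the order structure of [A]: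
   they are nonnegative on sums of squares and together determine the norm. *)
Lemma sum_squares_approx (ys : seq A) (c : R) :
  \sum_(y <- ys) star y * y = c%:C%C *: 1 ->
  exists K, forall e, 0 < e -> e <= 1 -> exists h : A -> gpoly R G,
    (forall y, cnorm (y - gp_eval U (h y)) < e) /\
    (forall (H : hilbertType R) (pi : unitaryRep G H) x,
      `|\sum_(y <- ys) nrm (rep_gp pi (h y) x) ^+ 2 - c * nrm x ^+ 2|
        <= K * e * nrm x ^+ 2).
Proof.
(* With [z] within [e <= 1] of [y], the squares differ by at most [(cnorm z + cnorm y) * e <= (2 *
   cnorm y + 1) * e]. *)
move=> ysc; exists (\sum_(y <- ys) (2 * cnorm y + 1)) => e e0 e1.
have /choice[h hP] : forall y : A, exists s, cnorm (y - gp_eval U s) < e.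
  by move=> y; exact: gpoly_dense.
exists h; split=> // H pi x.
pose q := flatten [seq gp_mul (gp_star (h y)) (h y) | y <- ys].
(* [d] is the sum of squares of the approximants minus [c]: small in [A], and its vector state at
   [x] is the quantity to be bounded. *)
pose d := q ++ gp_opp [:: (c%:C%C, 1%g)].
have dle : cnorm (gp_eval U d) <= (\sum_(y <- ys) (2 * cnorm y + 1)) * e.
  rewrite /d gp_eval_cat gp_eval_opp gp_eval_cons gp_eval_nil addr0 /= (fgc_1 hU).
  rewrite -ysc /q gp_eval_flatten big_map -sumrB mulr_suml.
  apply: le_trans (ler_cnorm_sum _ _) _; apply: ler_sum => y _.
  rewrite gp_eval_mul gp_eval_star; set z := gp_eval U (h y).
  have -> : star z * z - star y * y = - (star z * (y - z) + star (y - z) * y).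
    rewrite mulrBr (_ : star (y - z) = star y - star z).
      by rewrite mulrBl opprD !opprB addrA subrK.
    by rewrite starD -[- z]scaleN1r starZ rmorphN rmorph1 scaleN1r.
  rewrite cnormN; apply: le_trans (ler_cnormD _ _) _.
  have := ler_cnormM (star z) (y - z); have := ler_cnormM (star (y - z)) y.
  rewrite !cnorm_star; have := hP y; rewrite -/z => yz.
  have zy : cnorm z <= cnorm y + e.
    have -> : z = y - (y - z) by rewrite subKr.
    by rewrite (le_trans (ler_cnormB _ _)) // lerD2l ltW.
  have := cnorm_ge0 y; have := cnorm_ge0 (y - z); have := cnorm_ge0 z; nra.
have dE : inner (rep_gp pi d x) x =
    (\sum_(y <- ys) nrm (rep_gp pi (h y) x) ^+ 2 - c * nrm x ^+ 2)%:C%C.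
  rewrite /d /rep_gp gp_eval_cat gp_eval_opp gp_eval_cons gp_eval_nil addr0 rep1.
  rewrite linearBl linearZl_LR /= rmorphB rmorphM /= rmorphXn /= -nrmE -inner_norm.
  congr (_ - _); rewrite gp_eval_flatten big_map; elim: (ys) => [|y r IH].
    by rewrite !big_nil linear0l.
  rewrite !big_cons linearDl /= IH rmorphD /=; congr (_ + _).
  rewrite -[X in inner X _]/(rep_gp pi _ x) rep_gp_mul inner_rep_gp_star.
  by rewrite inner_norm nrmE rmorphXn.
move/(congr1 (@complex.Re R)): dE => /= <-.
apply: le_trans (re_inner_le _ _) _; rewrite expr2 mulrA ler_wpM2r ?nrm_ge0 //.
by apply: le_trans (nrm_rep_gp_le _ _ _) _; rewrite ler_wpM2r ?nrm_ge0.
Qed.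

(** A vector state is nonnegative on each square, so a small sum makes each term small. In all
    representations at once this bounds the norm of the approximant of [y]. *)
Lemma sum_squares_eq0 (ys : seq A) :
  \sum_(y <- ys) star y * y = 0 -> {in ys, forall y, y = 0}.
Proof.
move=> ys0 y yys; have := @sum_squares_approx ys 0; rewrite scale0r => /(_ ys0)[K KP].
have sq : forall e, 0 < e -> e <= 1 -> cnorm (star y * y) <= (2 * K + 2) * e.
  move=> e e0 e1; have [h [hy hK]] := KP e e0 e1.
  have sy (H : hilbertType R) (pi : unitaryRep G H) x :
      nrm (rep_gp pi (h y) x) ^+ 2 <= K * e * nrm x ^+ 2.
    have := hK H pi x; rewrite mul0r subr0 ger0_norm; last first.
      by apply: sumr_ge0 => z _; exact: sqr_ge0.
    apply: le_trans; rewrite (perm_big _ (perm_to_rem yys)) big_cons lerDl.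
    by apply: sumr_ge0 => z _; exact: sqr_ge0.
  (* A nonzero vector shows [0 <= K * e], so that the square root below squares back to [K * e]. *)
  have [H0 [pi0 [x0 x0_gt0]]] := exists_rep_neq0.
  have Ke0 : 0 <= K * e.
    have := le_trans (sqr_ge0 _) (sy _ pi0 x0).
    by rewrite pmulr_lge0 ?exprn_gt0.
  have zle : cnorm (gp_eval U (h y)) <= Num.sqrt (K * e).
    apply: cnorm_gp_eval_le => [|H pi x]; first exact: sqrtr_ge0.
    rewrite -ler_sqr ?nnegrE ?mulr_ge0 ?nrm_ge0 ?sqrtr_ge0 //.
    by rewrite exprMn sqr_sqrtr.
  rewrite cnorm_cstar; have yz := hy y; set z := gp_eval U (h y) in zle yz.
  have yle : cnorm y <= cnorm z + e.
    by rewrite -{1}(subrK z y) addrC (le_trans (ler_cnormD _ _)) // lerD2l ltW.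
  have zle2 : cnorm z ^+ 2 <= K * e.
    by rewrite -[leRHS]sqr_sqrtr // ler_sqr ?nnegrE ?cnorm_ge0 ?sqrtr_ge0.
  (* [(cnorm z + e)^2 <= 2 * cnorm z ^+ 2 + 2 * e ^+ 2], and [e ^+ 2 <= e]; this is the origin of
     [2 * K + 2]. *)
  have := cnorm_ge0 y; have := cnorm_ge0 z; have := sqr_ge0 (cnorm z - e); nra.
have := cnorm_eps_eq0 sq => /(congr1 (@cnorm _ _)); rewrite cnorm_cstar cnorm0.
by move/eqP; rewrite sqrf_eq0 => /eqP /cnorm0_eq0.
Qed.

(** A sum of squares is selfadjoint, so [c] is real; its sign is then read off from the state of one
    nonzero vector. *)
Lemma sum_squares_scalar (ys : seq A) (c : C) :
  \sum_(y <- ys) star y * y = c *: 1 -> 0 <= c.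
Proof.
move=> ysc; have cE : c = (complex.Re c)%:C%C.
  have : star (c *: (1 : A)) = c *: 1.
    rewrite -ysc (big_morph star (@starD _ A) (@star0 _ A)); apply: eq_bigr => y _.
    by rewrite starM starK.
  rewrite starZ star1 => /eqP; rewrite -subr_eq0 -scalerBl scaler_eq0 oner_eq0 orbF.
  rewrite subr_eq0; case: (c) => a b /eqP[/eqP]; rewrite eqNr => /eqP ->.
  by [].
move: ysc; rewrite cE ler0c; set r := complex.Re c => ysc.
have [K KP] := sum_squares_approx ysc.
have [H [pi [x x0]]] := exists_rep_neq0.
have rK e : 0 < e -> e <= 1 -> - (K * e) <= r.
  move=> e0 e1; have [h [_ hK]] := KP e e0 e1.
  have := hK H pi x; rewrite ler_norml => /andP[_].
  rewrite lerBlDr -mulrDl => le.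
  have : 0 <= (K * e + r) * nrm x ^+ 2.
    by apply: le_trans le; apply: sumr_ge0 => z _; exact: sqr_ge0.
  by rewrite pmulr_lge0 ?exprn_gt0 // -lerBlDl sub0r.
rewrite leNgt; apply/negP => r0.
have K0 : 0 < K by have := rK 1 ltr01 (lexx _); rewrite mulr1; lra.
(* For this [e], [rK] would give [r / 2 <= r] with [r < 0]. *)
pose e := Num.min 1 (- r / K / 2).
have e0 : 0 < e by rewrite lt_min ltr01 !divr_gt0 // oppr_gt0.
have e1 : e <= 1 by rewrite ge_min lexx.
have e2 : e <= - r / K / 2 by rewrite ge_min lexx orbT.
have := rK e e0 e1; have := ler_wpM2l (ltW K0) e2.
have -> : K * (- r / K / 2) = - r / 2 by field; rewrite gt_eqF.
lra.
Qed.

End FullGroup.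

(** * Representations of the free group *)

Section FreeGroupRep.
Variables (R : realType) (n : nat) (H : hilbertType R).
Local Notation letter := ('I_n * bool)%type.

Definition fg_letter (a : letter) : freeGroup n := @FreeGroup n [:: a] isT.

Lemma fg_mulE (g h : freeGroup n) : fg_word (g * h)%g = mul_red (fg_word g) (fg_word h).
Proof. by []. Qed.

(** No cancellation occurs when a reduced word is multiplied up letter by letter. *)
Lemma rep_foldr (pi : unitaryRep (freeGroup n) H) g x :
  pi g x = foldr (fun a => pi (fg_letter a)) x (fg_word g).
Proof.
case: g => w rw; elim: w rw => [|a w IH] rw /=.
  by rewrite -[RHS](rep1 pi); congr (pi _ x); apply: val_inj.
have rw' := reduced_cons rw; rewrite -(IH rw') -repM; congr (pi _ x).
apply: val_inj; rewrite /=.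
by case: w rw {IH rw'} => //= b w /andP[/negPf ->].
Qed.

Variable act : letter -> {linear H -> H}.
Hypothesis actK : forall a x, act (letter_inv a) (act a x) = x.
Hypothesis actU : forall a x y, inner (act a x) (act a y) = inner x y.

Definition word_act (w : seq letter) : {linear H -> H} :=
  foldr (fun a (f : {linear H -> H}) => act a \o f : {linear H -> H})
    (idfun : {linear H -> H}) w.

Lemma word_actE w x : word_act w x = foldr (fun a => act a) x w.
Proof. by elim: w => //= a w ->. Qed.

(** Cancelling two adjacent letters is harmless because [actK] makes them act as mutual inverses.
    Multiplicativity, and thus the universal property behind [free_rep], rests on this. *)
Lemma word_act_cons_red a w x : word_act (cons_red a w) x = act a (word_act w x).
Proof.
case: w => //= b w; case: ifP => [/eqP ->|//] /=.
by have := actK (letter_inv a) (word_act w x); rewrite letter_invK => ->.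
Qed.

Fact word_act1 x : word_act (fg_word (1%g : freeGroup n)) x = x.
Proof. by []. Qed.

Fact word_actM (g h : freeGroup n) x :
  word_act (fg_word (g * h)%g) x = word_act (fg_word g) (word_act (fg_word h) x).
Proof.
rewrite fg_mulE; elim: (fg_word g) => //= a w IH.
by rewrite word_act_cons_red IH.
Qed.

Fact word_actU (g : freeGroup n) x y :
  inner (word_act (fg_word g) x) (word_act (fg_word g) y) = inner x y.
Proof. by elim: (fg_word g) => //= a w IH; rewrite actU. Qed.

Definition free_rep : unitaryRep (freeGroup n) H :=
  UnitaryRep word_act1 word_actM word_actU.

Lemma free_repE g x : free_rep g x = foldr (fun a => act a) x (fg_word g).
Proof. exact: word_actE. Qed.

End FreeGroupRep.

Lemma fg_letterV n (a : 'I_n * bool) : fg_letter (letter_inv a) = ((fg_letter a)^-1)%g.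
Proof. by apply: val_inj. Qed.

(** * Linking two representations by a rotation *)

Section Link.
Variables (R : realType) (n : nat) (H : hilbertType R).
Variables (V W : unitaryRep (freeGroup n) H) (k : 'I_n).
Hypothesis VW : forall x, V (fg_gen k) x = W (fg_gen k) x.
Local Notation letter := ('I_n * bool)%type.
Local Notation HH := (dsum H H).

Definition dsum_rep (g : freeGroup n) (x : HH) : HH := (V g x.1, W g x.2).

Definition rot (t : R) (x : HH) : HH :=
  ((cos t)%:C%C *: x.1 - (sin t)%:C%C *: x.2,
   (sin t)%:C%C *: x.1 + (cos t)%:C%C *: x.2).

(** The inverse letter turns backwards, so that [link_fun] respects inverses; the letters of the
    other generators do not turn at all. *)
Definition angle (t : R) (a : letter) : R :=
  if a.1 == k then if a.2 then - t else t else 0.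

Definition link_fun (t : R) (a : letter) (x : HH) : HH :=
  dsum_rep (fg_letter a) (rot (angle t a) x).

Lemma rot_linear t : linear (rot t).
Proof.
move=> c x y; congr pair => /=; rewrite !scalerDr !scalerA !(mulrC _ c) -!scalerA.
  by rewrite opprD addrACA scalerN.
by rewrite addrACA.
Qed.

Lemma dsum_rep_linear g : linear (dsum_rep g).
Proof. by move=> c x y; congr pair => /=; rewrite linearP. Qed.

Fact link_fun_linear t a : linear (link_fun t a).
Proof. by move=> c x y; rewrite /link_fun rot_linear dsum_rep_linear. Qed.

HB.instance Definition _ t a :=
  GRing.isLinear.Build R[i] HH HH *:%R (link_fun t a) (link_fun_linear t a).

Lemma rotD s t x : rot s (rot t x) = rot (s + t) x.
Proof.
rewrite /rot cosD sinD /=; congr pair; rewrite !(scalerDr, scalerN, scalerA).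
  rewrite rmorphB rmorphD /= !rmorphM /= scalerBl scalerDl !opprD addrACA.
  by rewrite [X in _ + X]addrC.
rewrite rmorphB rmorphD /= !rmorphM /= scalerBl scalerDl addrACA.
by rewrite [X in _ + X]addrC.
Qed.

Lemma rot0 x : rot 0 x = x.
Proof. by case: x => x y; rewrite /rot cos0 sin0 /= !scale1r !scale0r subr0 add0r. Qed.

Lemma VW_letter b x : V (fg_letter (k, b)) x = W (fg_letter (k, b)) x.
Proof.
case: b; last exact: VW.
have -> : fg_letter (k, true) = ((fg_gen k)^-1)%g by rewrite -fg_letterV.
by rewrite -[x in LHS](rep1 W) -(mulgV (fg_gen k)) repM -VW repK.
Qed.

(** A rotation mixes the summands by scalars, so it commutes with the direct sum at the letters of
    [k], where [V] and [W] agree; at any other letter the angle is [0]. *)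
Lemma dsum_rep_rot t a x :
  dsum_rep (fg_letter a) (rot (angle t a) x) = rot (angle t a) (dsum_rep (fg_letter a) x).
Proof.
case: a => j b; rewrite /angle /=; have [->|_] := eqVneq j k; last by rewrite !rot0.
rewrite /dsum_rep /rot /=; set s := if b then _ else _; congr pair.
  by rewrite linearB !linearZ /= !VW_letter.
by rewrite linearD !linearZ /= !VW_letter.
Qed.

Fact link_funK t a x : link_fun t (letter_inv a) (link_fun t a x) = x.
Proof.
rewrite /link_fun [X in rot _ X]dsum_rep_rot rotD.
rewrite (_ : angle t _ + _ = 0) ?rot0; last first.
  by case: a => j []; rewrite /angle /=; case: ifP; rewrite ?addr0 ?addNr ?subrr.
by rewrite /dsum_rep /= fg_letterV !repK; case: x.
Qed.

Lemma dsum_rep_inner g x y : inner (dsum_rep g x) (dsum_rep g y) = inner x y.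
Proof. by rewrite /inner /= /dsum_inner /= !repU. Qed.

Lemma rot_inner t x y : inner (rot t x) (rot t y) = inner x y.
Proof.
rewrite /inner /= /dsum_inner /rot /=.
have sc (c : R) : Num.conj (c%:C%C) = c%:C%C.
  by apply/eqP; rewrite eq_complex /= oppr0 !eqxx.
rewrite !(linearBl, linearDl) !(linearBr, linearDr) !linearZl_LR !linearZr_LR /= !sc.
have := cos2Dsin2 t => /(congr1 (real_complex R)); rewrite rmorphD !rmorphXn /= => cs.
move: (inner _ _) (inner _ _) (inner _ _) (inner _ _) => p q r s.
rewrite -[RHS]mul1r -[1]cs /GRing.scale /=; ring.
Qed.

Fact link_funU t a x y : inner (link_fun t a x) (link_fun t a y) = inner x y.
Proof. by rewrite dsum_rep_inner rot_inner. Qed.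

Definition link_rep (t : R) : unitaryRep (freeGroup n) HH :=
  @free_rep R n HH (link_fun t) (link_funK t) (link_funU t).

Lemma rot_dist t x : nrm (rot t x - x) <= (`|1 - cos t| + `|sin t|) * nrm x.
Proof.
(* The quarter turn [J] is isometric, and [rot t - 1 = - (1 - cos t) + sin t * J]. *)
pose Jx : HH := (- x.2, x.1).
have -> : rot t x - x = - ((1 - cos t)%:C%C *: x) + (sin t)%:C%C *: Jx.
  rewrite /rot rmorphB rmorph1 scalerBl scale1r; case: x @Jx => x y Jx.
  congr pair; rewrite /= ?scalerN.
    by rewrite opprB addrAC.
  by rewrite opprB -addrA addrC.
apply: le_trans (ler_nrmD _ _) _; rewrite nrmN !nrmZ !nrmc mulrDl lerD2l.
by rewrite !nrm_dsum /= nrmN [in leLHS]addrC.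
Qed.

(** Exchange the letters one at a time: each costs at most the displacement of [rot_dist], and
    isometries carry the earlier errors along without enlarging them. *)
Lemma link_rep_dist t g x :
  nrm (link_rep t g x - dsum_rep g x)
    <= (size (fg_word g))%:R * (`|1 - cos t| + `|sin t|) * nrm x.
Proof.
have -> : dsum_rep g x = foldr (fun a => dsum_rep (fg_letter a)) x (fg_word g).
  rewrite /dsum_rep rep_foldr [W g _]rep_foldr.
  by elim: (fg_word g) => [|a w /= <-] //; case: x.
rewrite free_repE; set d := (`|_| + _); have d0 : 0 <= d by rewrite addr_ge0.
elim: (fg_word g) => [|a w IH] /=; first by rewrite subrr nrm0 !mul0r.
set u := foldr _ x w in IH *; set v := foldr _ x w in IH *.
have isoD b (y z : HH) : nrm (dsum_rep b y - dsum_rep b z) = nrm (y - z).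
  rewrite -[RHS](nrm_inner (dsum_rep_inner b _ _)); congr nrm.
  by congr pair; rewrite /= linearB.
have uE : nrm u = nrm x.
  by rewrite /u; elim: (w) => //= b r <-; apply: nrm_inner; exact: link_funU.
rewrite [X in nrm (X - _)]/link_fun isoD -(subrKA u) -addn1 natrD !mulrDl mul1r addrC.
apply: le_trans (ler_nrmD _ _) _; rewrite lerD // -uE.
apply: le_trans (rot_dist _ _) _; rewrite ler_wpM2r ?nrm_ge0 //.
rewrite /angle; case: ifP => _; last by rewrite cos0 sin0 subrr normr0 addr0.
by case: ifP => _; rewrite // cosN sinN normrN.
Qed.

Lemma link_rep_pow t m x :
  link_rep t (fg_gen k ^+ m)%g x = dsum_rep (fg_gen k ^+ m)%g (rot (m%:R * t) x).
Proof.
elim: m => [|m IH] in x *.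
  by rewrite !expg0 rep1 mul0r rot0 /dsum_rep !rep1; case: x.
rewrite !expgSr !repM (_ : link_rep t (fg_gen k) x = dsum_rep (fg_gen k) (rot t x)).
  rewrite IH -natr1 mulrDl mul1r -rotD.
  have := @dsum_rep_rot (m%:R * t) (k, false) (rot t x).
  by rewrite /angle /= eqxx => <-; rewrite /dsum_rep /= !repM.
by rewrite free_repE /= /link_fun /angle /= eqxx.
Qed.

Lemma rot_pihalf x : rot (pi / 2) ((x, 0) : HH) = (0, x).
Proof. by rewrite /rot cos_pihalf sin_pihalf /= !scale0r scaler0 subr0 scale1r addr0. Qed.

Lemma small_angle (d : R) : 0 < d -> exists m : nat,
  `|1 - cos (pi / 2 / m.+1%:R)| + `|sin (pi / 2 / m.+1%:R)| <= d.
Proof.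
move=> d0; pose f t : R := `|1 - cos t| + `|sin t|.
have f0 : f t @[t --> (0 : R)] --> (0 : R).
  have f00 : f 0 = 0 by rewrite /f cos0 sin0 subrr normr0 addr0.
  rewrite -[X in _ --> X]f00.
  apply: cvgD; apply: cvg_norm; last exact: continuous_sin.
  by apply: cvgB; [exact: cvg_cst | exact: continuous_cos].
have u0 : (pi / 2 / m.+1%:R : R) @[m --> \oo] --> (0 : R).
  rewrite -[X in _ --> X](mulr0 (pi / 2)); apply: cvgM; first exact: cvg_cst.
  exact: cvg_harmonic.
have := cvg_comp _ _ u0 f0 => /cvgrPdist_le /(_ d d0) [m _ /(_ m (leqnn m))] /=.
by rewrite sub0r normrN ger0_norm ?addr_ge0 //; exists m.
Qed.

Lemma link_rep_gp_dist t s x :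
  nrm (rep_gp (link_rep t) s x - (rep_gp V s x.1, rep_gp W s x.2))
    <= (\sum_(p <- s) nrm p.1 * (size (fg_word p.2))%:R)
       * (`|1 - cos t| + `|sin t|) * nrm x.
Proof.
have -> : ((rep_gp V s x.1, rep_gp W s x.2) : HH) = \sum_(p <- s) p.1 *: dsum_rep p.2 x.
  rewrite /rep_gp /gp_eval; elim: s => [|p s IH]; first by rewrite !big_nil.
  by rewrite !big_cons -IH.
rewrite /rep_gp /gp_eval -sumrB !mulr_suml; apply: le_trans (ler_nrm_sum _ _) _.
apply: ler_sum => p _; rewrite -scalerBr nrmZ -!mulrA ler_wpM2l ?nrm_ge0 //.
by rewrite mulrA link_rep_dist.
Qed.

Lemma link_bound (s : gpoly R (freeGroup n)) (e B : R) :
  (forall t m (x : HH),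
     nrm (link_rep t (fg_gen k ^+ m)%g (rep_gp (link_rep t) s x)
          - rep_gp (link_rep t) s (link_rep t (fg_gen k ^+ m)%g x)) <= e * nrm x) ->
  (forall x, nrm (rep_gp W s x) <= B * nrm x) ->
  forall x, nrm (rep_gp V s x) <= (B + e) * nrm x.
Proof.
move=> comm WB x; set K := \sum_(p <- s) nrm p.1 * (size (fg_word p.2))%:R.
have K0 : 0 <= K by apply: sumr_ge0 => p _; rewrite mulr_ge0 ?nrm_ge0.
suff main d : 0 < d -> nrm (rep_gp V s x) <= (B + e + 2 * K * d) * nrm x.
  rewrite leNgt; apply/negP => lt.
  have D0 : 0 < 2 * K * nrm x + 1 by have := mulr_ge0 K0 (nrm_ge0 x); lra.
  (* With [y] the excess over [(B + e) * nrm x], this [d] makes the error term at most [y / 2]. The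
     [+ 1] keeps the denominator positive when [K * nrm x] is [0]. *)
  have d0 : 0 < (nrm (rep_gp V s x) - (B + e) * nrm x) / (2 * K * nrm x + 1) / 2.
    by rewrite !divr_gt0 // subr_gt0.
  have := main _ d0; set y := _ - _.
  have -> : (B + e + 2 * K * (y / (2 * K * nrm x + 1) / 2)) * nrm x =
    (B + e) * nrm x + y * ((2 * K * nrm x) / (2 * K * nrm x + 1)) / 2.
    by field; rewrite gt_eqF.
  have q1 : (2 * K * nrm x) / (2 * K * nrm x + 1) <= 1.
    by rewrite ler_pdivrMr // mul1r lerDl.
  have y0 : 0 < y by rewrite subr_gt0.
  have := ler_wpM2l (ltW y0) q1; rewrite mulr1 /y in y0 *; lra.
move=> /small_angle[m]; set t := pi / 2 / _; set d' := _ + _ => dd'.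
have tE : m.+1%:R * t = pi / 2 by rewrite /t mulrC divfK.
pose X := link_rep t; pose g := (fg_gen k ^+ m.+1)%g.
(* The [m.+1] turns by [t] add up to exactly a quarter turn, so [X g] sends [y] in the first summand
   to [z] in the second. *)
pose y : HH := (x, 0); pose z : HH := (0, W g x).
have XgE : X g y = z by rewrite /X link_rep_pow tE rot_pihalf /dsum_rep /= linear0.
have ny : nrm y = nrm x by exact: nrm_dsum_l.
have nz : nrm z = nrm x by rewrite nrm_dsum_r nrm_rep.
(* Up to [K * d'], the linked representation acts on [y] through [V] and on [z] through [W]. *)
have Vy : nrm (rep_gp V s x) <= nrm (rep_gp X s y) + K * d' * nrm x.
  have := link_rep_gp_dist t s y; rewrite /= rep_gp0 ny -/K -/d' -/X => dist.
  rewrite -(nrm_dsum_l H (rep_gp V s x)) -lerBlDl (le_trans _ dist) //.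
  by rewrite (le_trans (ler_nrmB _ _)) // -[leLHS]nrmN opprB.
have Wz : nrm (rep_gp X s z) <= B * nrm x + K * d' * nrm x.
  have := link_rep_gp_dist t s z; rewrite /= rep_gp0 nz -/K -/d' -/X => dist.
  have := WB (W g x); rewrite nrm_rep -(nrm_dsum_r H).
  by have := ler_nrmB (rep_gp X s z) (0, rep_gp W s (W g x)); lra.
(* Near-commutation with the isometry [X g] compares the norms at [y] and [z]. *)
have := comm t m.+1 y; rewrite -/X -/g XgE ny => cg.
have : nrm (rep_gp X s y) <= nrm (rep_gp X s z) + e * nrm x.
  rewrite -(nrm_rep X g) -lerBlDl; by rewrite (le_trans (ler_nrmB _ _) cg).
have : K * d' * nrm x <= K * d * nrm x by rewrite ler_wpM2r ?nrm_ge0 // ler_wpM2l.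
lra.
Qed.

End Link.

(** * Triviality of the centre *)

(** Scalars within [e] and [e'] of [a] differ by at most [e + e']. The intervals of radius [e]
    around their real parts thus meet pairwise, and the supremum of the left ends lies in all of
    them; likewise for imaginary parts. *)
Lemma near_scalars (R : realType) (A : cstarAlgType R) (a : A) :
  (forall e, 0 < e -> exists c : R[i], cnorm (a - c *: 1) <= e) ->
  exists c : R[i], a = c *: 1.
Proof.
move=> ac.
have near (f : R[i] -> R) : (forall c d, f c - f d <= nrm (c - d)) ->
    exists r, forall c e, cnorm (a - c *: 1) <= e -> `|f c - r| <= e.
  move=> fL; pose E := [set r | exists c e, cnorm (a - c *: 1) <= e /\ r = f c - e].
  have EL c e d e' : cnorm (a - c *: 1) <= e -> cnorm (a - d *: 1) <= e' ->
      f c - e <= f d + e'.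
    move=> ce de; rewrite lerBlDr -addrA -lerBlDl (le_trans (fL c d)) //.
    have -> : nrm (c - d) = cnorm ((c - d) *: (1 : A)) by rewrite cnormZ cnorm1 mulr1.
    have -> : (c - d) *: (1 : A) = (a - d *: 1) - (a - c *: 1).
      by rewrite opprB [RHS]addrC addrA subrK scalerBl.
    by rewrite (le_trans (ler_cnormB _ _)) // lerD.
  have ubE c e : cnorm (a - c *: 1) <= e -> ubound E (f c + e).
    by move=> ce _ [d [e' [de ->]]]; exact: EL.
  exists (sup E) => c e ce; rewrite ler_distlC; apply/andP; split.
    by apply: ub_le_sup; [exists (f c + e); exact: ubE | exists c, e].
  by apply: ge_sup; [exists (f c - e), c, e | exact: ubE].
have [x xP] : exists x, forall c e, cnorm (a - c *: 1) <= e -> `|complex.Re c - x| <= e.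
  apply: near => -[c1 c2] [d1 d2]; rewrite /nrm normc_def /=.
  rewrite (le_trans (ler_norm _)) // -sqrtr_sqr ler_sqrt ?lerDl ?sqr_ge0 //.
  by rewrite addr_ge0 ?sqr_ge0.
have [y yP] : exists y, forall c e, cnorm (a - c *: 1) <= e -> `|complex.Im c - y| <= e.
  apply: near => -[c1 c2] [d1 d2]; rewrite /nrm normc_def /=.
  rewrite (le_trans (ler_norm _)) // -sqrtr_sqr ler_sqrt ?lerDr ?sqr_ge0 //.
  by rewrite addr_ge0 ?sqr_ge0.
exists (Complex x y); apply/eqP; rewrite -subr_eq0; apply/eqP.
(* One [e] for the distance from [a] to [c *: 1], one for each of the real and imaginary parts. *)
apply: (@cnorm_eps_eq0 _ _ _ 3) => e e0 _; have [c ce] := ac e e0.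
rewrite -(subrKA (c *: 1)) (le_trans (ler_cnormD _ _)) //.
rewrite -scalerBl cnormZ cnorm1 mulr1 -/(nrm _).
have : nrm (c - Complex x y) <= `|complex.Re c - x| + `|complex.Im c - y|.
  case: (c) => c1 c2; rewrite /nrm normc_def /=.
  have := minkowski2 (c1 - x) 0 0 (c2 - y).
  by rewrite expr0n !addr0 !add0r !sqrtr_sqr.
by have := xP _ _ ce; have := yP _ _ ce; lra.
Qed.

Section Center.
Variables (R : realType) (n : nat) (A : cstarAlgType R) (U : freeGroup n -> A).
Hypothesis hU : is_full_group_cstar U.

(** The commutator of [U g] with the approximant is that with its difference from [a], of norm at
    most [2 * e]; representations do not increase norms. *)
Lemma commute_rep_bound (a : A) (s : gpoly R (freeGroup n)) (e : R) g :
  a * U g = U g * a -> cnorm (a - gp_eval U s) <= e ->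
  forall (H : hilbertType R) (pi : unitaryRep (freeGroup n) H) x,
  nrm (pi g (rep_gp pi s x) - rep_gp pi s (pi g x)) <= 2 * e * nrm x.
Proof.
move=> ag ae H pi x; pose d : gpoly R (freeGroup n) := [:: (1, g)].
have dE y : rep_gp pi d y = pi g y.
  by rewrite /rep_gp gp_eval_cons gp_eval_nil addr0 scale1r.
rewrite -!dE -!rep_gp_mul.
have -> : rep_gp pi (gp_mul d s) x - rep_gp pi (gp_mul s d) x =
          rep_gp pi (gp_mul d s ++ gp_opp (gp_mul s d)) x.
  by rewrite /rep_gp gp_eval_cat gp_eval_opp.
apply: le_trans (nrm_rep_gp_le hU _ _ _) _; rewrite ler_wpM2r ?nrm_ge0 //.
rewrite gp_eval_cat gp_eval_opp !gp_eval_mul // gp_eval_cons gp_eval_nil addr0 scale1r /=.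
set z := gp_eval U s in ae *.
have -> : U g * z - z * U g = (a - z) * U g - U g * (a - z).
  by rewrite mulrBl mulrBr ag opprB [RHS]addrC addrA subrK.
have Ug : cnorm (U g) = 1.
  apply/eqP; rewrite -(eqrXn2 (n := 2)) ?cnorm_ge0 // expr1n -cnorm_cstar.
  by rewrite (fgc_star hU) -(fgc_M hU) mulVg (fgc_1 hU) cnorm1.
apply: le_trans (ler_cnormB _ _) _.
have := ler_cnormM (a - z) (U g); have := ler_cnormM (U g) (a - z).
by rewrite Ug mulr1 mul1r; lra.
Qed.

Lemma commute_U_pow (a : A) g m : a * U g = U g * a ->
  a * U (g ^+ m)%g = U (g ^+ m)%g * a.
Proof.
move=> ag; elim: m => [|m IH]; first by rewrite expg0 (fgc_1 hU) mulr1 mul1r.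
by rewrite expgS (fgc_M hU) mulrA ag -mulrA IH mulrA.
Qed.

Section LetterRep.
Variables (H : hilbertType R) (V : unitaryRep (freeGroup n) H) (P : pred 'I_n).

Definition restr_act (a : 'I_n * bool) : {linear H -> H} :=
  if P a.1 then V (fg_letter a) else (idfun : {linear H -> H}).

Fact restr_actK a x : restr_act (letter_inv a) (restr_act a x) = x.
Proof. by rewrite /restr_act /=; case: ifP => // _; rewrite fg_letterV repK. Qed.

Fact restr_actU a x y : inner (restr_act a x) (restr_act a y) = inner x y.
Proof. by rewrite /restr_act; case: ifP => // _; rewrite repU. Qed.

Definition restr_rep := free_rep restr_actK restr_actU.

Lemma restr_rep_gen k x :
  restr_rep (fg_gen k) x = if P k then V (fg_gen k) x else x.
Proof. by rewrite free_repE /= /restr_act /=; case: ifP. Qed.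

End LetterRep.

Lemma restr_rep0 (H : hilbertType R) (V : unitaryRep (freeGroup n) H) g x :
  restr_rep V pred0 g x = x.
Proof. by rewrite free_repE; elim: (fg_word g) => //= b w ->. Qed.

(* Any representation is linked through [j] to one that kills all the other
   generators, and this one is linked through [k] to the trivial one. *)
Lemma commutant_two_generators (a : A) (j k : 'I_n) : j != k ->
  a * U (fg_gen j) = U (fg_gen j) * a -> a * U (fg_gen k) = U (fg_gen k) * a ->
  exists c : R[i], a = c *: 1.
Proof.
move=> jk aj ak; apply: near_scalars => e e0.
(* One fifth pays for approximating [a], and two fifths for each of the two links. *)
have e5 : 0 < e / 5 by rewrite divr_gt0.
(* [c] is the value of [s] in the trivial representation, so [s'] below vanishes there. *)
have [s se] := gpoly_dense hU a e5; pose c := \sum_(p <- s) p.1; exists c.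
pose s' := s ++ gp_opp [:: (c, 1%g)].
have s'E : gp_eval U s' = gp_eval U s - c *: 1.
  by rewrite gp_eval_cat gp_eval_opp gp_eval_cons gp_eval_nil addr0 (fgc_1 hU).
have s'e : cnorm (a - c *: 1 - gp_eval U s') <= e / 5.
  by rewrite s'E opprB addrA subrK ltW.
have comm i : a * U (fg_gen i) = U (fg_gen i) * a ->
    forall (K : hilbertType R) (pi : unitaryRep (freeGroup n) K) m x,
    nrm (pi (fg_gen i ^+ m)%g (rep_gp pi s' x)
         - rep_gp pi s' (pi (fg_gen i ^+ m)%g x)) <= 2 * (e / 5) * nrm x.
  move=> /commute_U_pow ai K pi m; apply: commute_rep_bound s'e K pi.
  by rewrite mulrBl mulrBr ai -scalerAl -scalerAr mulr1 mul1r.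
rewrite -(subrK (gp_eval U s') (a - c *: 1)) (le_trans (ler_cnormD _ _)) //.
suff : cnorm (gp_eval U s') <= 4 * (e / 5) by lra.
apply: (cnorm_gp_eval_le hU) => [|H V x]; first by rewrite mulr_ge0 // ltW.
pose V0 := restr_rep V pred0; pose V1 := restr_rep V (pred1 j).
have V0s y : nrm (rep_gp V0 s' y) <= 0 * nrm y.
  rewrite /rep_gp gp_eval_cat gp_eval_opp gp_eval_cons gp_eval_nil addr0 rep1.
  rewrite /gp_eval (eq_bigr (fun p => p.1 *: y)) => [|p _]; last by rewrite restr_rep0.
  by rewrite -scaler_suml subrr nrm0 mul0r.
have V10 y : V1 (fg_gen k) y = V0 (fg_gen k) y.
  by rewrite restr_rep0 restr_rep_gen /= eq_sym (negPf jk).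
have VV1 y : V (fg_gen j) y = V1 (fg_gen j) y by rewrite restr_rep_gen /= eqxx.
have V1s := link_bound (fun t m => comm k ak _ (link_rep V10 t) m) V0s.
have := link_bound (fun t m => comm j aj _ (link_rep VV1 t) m) V1s x.
by congr (_ <= _ * _); lra.
Qed.

End Center.

(** * Purity *)

Section Purity.
Variables (R : realType) (n : nat) (A : cstarAlgType R) (U : freeGroup n -> A).
Hypothesis hU : is_full_group_cstar U.
Local Notation u := (fun k : 'I_n => U (fg_gen k)).
Local Notation S := (span_opsys u).

Lemma gen_star_mul k : star (u k) * u k = 1.
Proof. by rewrite (fgc_star hU) -(fgc_M hU) mulVg (fgc_1 hU). Qed.

Lemma gen_mul_star k : u k * star (u k) = 1.
Proof. by rewrite (fgc_star hU) -(fgc_M hU) mulgV (fgc_1 hU). Qed.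

Fact gen_in_span k : u k \in opsys_pred S.
Proof.
apply/span_predP; exists 0, (fun i => (i == k)%:R), (fun=> 0).
rewrite scale0r add0r (bigD1 k) //= eqxx scale1r scale0r addr0 big1 ?addr0 // => i /negPf ->.
by rewrite !scale0r addr0.
Qed.

Definition sys1 : S := OpSysElt (opsys_1 S).
Definition sysu k : S := OpSysElt (gen_in_span k).
Definition sysu_star k : S := OpSysElt (opsys_star (gen_in_span k)).

Lemma sys_decomp (x : S) : exists (a : R[i]) (b c : 'I_n -> R[i]),
  x = a *: sys1 + \sum_(k < n) (b k *: sysu k + c k *: sysu_star k).
Proof.
have /span_predP[a [b [c xE]]] := opsys_valP x; exists a, b, c.
apply: val_inj; rewrite [LHS]xE -[RHS]/(opsys_incl S _).
by rewrite linearD linearZ linear_sum.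
Qed.

Definition gen_mx k : 'M[S]_2 :=
  \matrix_(i, j) if i == j then sys1 else if i == 0 then sysu k else sysu_star k.

Lemma gen_mx_positive k : mx_positive (map_mx (opsys_incl S) (gen_mx k)).
Proof.
(* The row [(1, u)] alone has the required square; a zero row makes it a square matrix. *)
exists (\matrix_(i, j) if i == 0 then if j == 0 then 1 else u k else 0).
apply/matrixP => i j; rewrite !mxE !big_ord_recl big_ord0 !mxE /= star0 mul0r !addr0.
case: i j => [[|[|//]] i2] [[|[|//]] j2] /=.
- by rewrite star1 mulr1.
- by rewrite star1 mul1r.
- by rewrite mulr1.
- by rewrite gen_star_mul.
Qed.

Lemma mx_square_entry (Y : 'M[A]_2) i j :
  ((map_mx star Y)^T *m Y) i j = \sum_l star (Y l i) * Y l j.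
Proof. by rewrite mxE; apply: eq_bigr => l _; rewrite !mxE. Qed.

(** The quadratic form of [X] at the vector [(v, -1)], expanded as a sum of squares: if it vanishes,
    [Y] kills that vector. *)
Lemma sum_square_column (Y : 'M[A]_2) v (X := (map_mx star Y)^T *m Y) :
  \sum_l star (Y l 0 * v - Y l 1) * (Y l 0 * v - Y l 1) =
  star v * X 0 0 * v - star v * X 0 1 - X 1 0 * v + X 1 1.
Proof.
rewrite !mx_square_entry !mulr_sumr !mulr_suml -!sumrN -!big_split /=.
apply: eq_bigr => l _; rewrite [star (_ - _)]starD -[- Y l 1 in LHS]scaleN1r starZ.
rewrite rmorphN rmorph1 !scaleN1r starM mulrBl !mulrBr !mulrA.
by rewrite opprD opprK addrA.
Qed.

Lemma gen_mx_summand k (theta omega : {linear S -> A}) :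
  completely_positive theta -> completely_positive omega ->
  (forall x, theta x + omega x = opsys_incl S x) ->
  [/\ theta (sysu k) = theta sys1 * u k,
      theta (sysu_star k) = star (u k) * theta sys1 &
      theta sys1 * u k = u k * theta sys1].
Proof.
move=> /(_ _ _ (gen_mx_positive k))[Y YE] /(_ _ _ (gen_mx_positive k))[Z ZE] to.
have X00 := congr1 (fun X : 'M[A]_2 => X 0 0) YE.
have X01 := congr1 (fun X : 'M[A]_2 => X 0 1) YE.
have X10 := congr1 (fun X : 'M[A]_2 => X 1 0) YE.
have X11 := congr1 (fun X : 'M[A]_2 => X 1 1) YE.
rewrite !mx_square_entry !mxE /= in X00 X01 X10 X11.
pose y (l : 'I_2) := Y l 0 * u k - Y l 1; pose z (l : 'I_2) := Z l 0 * u k - Z l 1.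
(* The squares for [theta] and [omega] are taken together, as only the sum of the two maps is known:
   there the form at [(u, -1)] is [1 - 1 - 1 + 1]. *)
have sum0 : \sum_(x <- map y (index_enum 'I_2) ++ map z (index_enum 'I_2)) star x * x = 0.
  rewrite big_cat !big_map /= /y /z !sum_square_column -YE -ZE !mxE /=.
  rewrite addrACA [X in X + _]addrACA [X in X + _ + _]addrACA -!opprD.
  rewrite -!mulrDl -!mulrDr !to /= mulr1 !gen_star_mul subrr sub0r addNr //.
have yl l : Y l 1 = Y l 0 * u k.
  apply/eqP; rewrite eq_sym -subr_eq0; apply/eqP.
  apply: (sum_squares_eq0 hU sum0); rewrite mem_cat; apply/orP; left.
  exact: map_f (mem_index_enum l).
have {}X01 : theta (sysu k) = theta sys1 * u k.
  by rewrite X01 X00 mulr_suml; apply: eq_bigr => l _; rewrite yl mulrA.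
have {}X10 : theta (sysu_star k) = star (u k) * theta sys1.
  rewrite X10 X00 mulr_sumr; apply: eq_bigr => l _.
  by rewrite yl starM mulrA.
(* Multiplying this identity by [u] on the left yields the commutation. *)
have X11' : theta sys1 = star (u k) * theta sys1 * u k.
  rewrite {1}X11 X00 mulr_sumr mulr_suml; apply: eq_bigr => l _.
  by rewrite yl starM !mulrA.
by split=> //; rewrite {2}X11' !mulrA gen_mul_star mul1r.
Qed.

(** [theta sys1] is a diagonal entry of a positive matrix, hence the sum of squares of a column of
    [Y]. *)
Lemma theta1_ge0 (k : 'I_n) (theta : {linear S -> A}) c :
  completely_positive theta -> theta sys1 = c *: 1 -> 0 <= c.
Proof.
move=> /(_ _ _ (gen_mx_positive k))[Y YE] tc.
apply: (sum_squares_scalar hU (ys := [seq Y l 0 | l <- index_enum 'I_2])).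
by rewrite big_map /= -mx_square_entry -YE !mxE.
Qed.

End Purity.

Theorem corollary4p4 (R : realType) (n : nat) (hn : (2 <= n)%N)
    (A : cstarAlgType R) (U : freeGroup n -> A)
    (hA : is_full_group_cstar U) :
  pure_in_CP (opsys_incl (span_opsys (fun k : 'I_n => U (fg_gen k)))).
Proof.
(* For the inclusion, the hypothesis and conclusion of complete positivity coincide. *)
split=> // theta omega thetaP omegaP to.
pose k0 : 'I_n := Ordinal (ltnW hn); pose k1 : 'I_n := Ordinal hn.
have tg k := gen_mx_summand hA k thetaP omegaP to.
have [|||c tc] := @commutant_two_generators _ _ _ _ hA (theta (sys1 U)) k0 k1.
- by [].
- by have [_ _] := tg k0.
- by have [_ _] := tg k1.
have oc : omega (sys1 U) = (1 - c) *: 1.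
  by rewrite scalerBl scale1r -tc -[X in X - _](to (sys1 U)) addrC addKr.
have c0 := theta1_ge0 hA k0 thetaP tc.
have c1 := theta1_ge0 hA k0 omegaP oc.
(* Nonnegativity in the order of [R[i]] includes being real. *)
have cE : c = (complex.Re c)%:C%C by rewrite RRe_real // ger0_real.
have tE x : theta x = c *: opsys_incl _ x.
  have [a [b [d ->]]] := sys_decomp x; rewrite !linearD !linearZ !linear_sum /=.
  rewrite tc; congr (_ + _); apply: eq_bigr => k _.
  have [tu tus _] := tg k; rewrite linearD !linearZ /= tu tus tc.
  by rewrite -scalerAl -scalerAr mul1r mulr1 scalerDr !scalerA ![_ * c]mulrC.
exists (complex.Re c); split.
- by rewrite -!lecR -cE c0 -subr_ge0 c1.
- by move=> x; rewrite -cE tE.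
- move=> x; rewrite rmorphB rmorph1 /= -cE scalerBl scale1r -tE.
  by rewrite -[X in X - _](to x) addrC addKr.
Qed.
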